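(* Let $A,B$ be real $3\times 3$ matrices and let $X(\mathbf{x})=A\mathbf{x}$, $Y(\mathbf{x})=B\mathbf{x}$ be linear vector fields on $\mathbb{R}^3$ that are inelastic over the unit sphere $\Sigma_1=\{\mathbf{x}\in\mathbb{R}^3:\ x_1^2+x_2^2+x_3^2=1\}$. Let $S_1$ be the associated sliding vector field, regarded as a vector field on the whole sphere $\Sigma_1$. If $S_1$ is non-trivial (not identically zero), then $S_1$ has two equilibrium points $p_+,p_-\in\Sigma_1$, and every other trajectory of $S_1$ is closed and equal to the intersection of $\Sigma_1$ with a plane orthogonal to the line $\overline{p_+p_-}$ joining the two equilibria.
   Context: Write $\mathbf{x}=(x_1,x_2,x_3)$ and $\sigma_1(\mathbf{x})=x_1^2+x_2^2+x_3^2-1$, so $\Sigma_1=\sigma_1^{-1}(\{0\})$. For a vector field $W$ and a function $h$, $Wh(\mathbf{x})=W(\mathbf{x})\cdot\nabla h(\mathbf{x})$. The vector fields $X,Y$ are inelastic over $\Sigma_1$ if $(X\sigma_1)(\mathbf{x})=-(Y\sigma_1)(\mathbf{x})$ for all $\mathbf{x}\in\Sigma_1$. Let $\Sigma_1^*=\{\mathbf{x}\in\Sigma_1:\ X\sigma_1(\mathbf{x})\,Y\sigma_1(\mathbf{x})\neq 0\}$. The sliding vector field is defined on $\Sigma_1^*$ by $$S_1(\mathbf{x})=\frac{1}{Y\sigma_1(\mathbf{x})-X\sigma_1(\mathbf{x})}\Big(Y\sigma_1(\mathbf{x})\,X(\mathbf{x})-X\sigma_1(\mathbf{x})\,Y(\mathbf{x})\Big).$$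 When $\Sigma_1^*\neq\emptyset$ it is regarded as a vector field on all of $\Sigma_1$ through its continuous extension from $\Sigma_1^*$ to $\Sigma_1$. The non-triviality hypothesis presupposes $\Sigma_1^*\neq\emptyset$. *)

(* Defs.v *)
From HB Require Import structures.
From mathcomp Require Import all_boot all_order all_algebra.
From mathcomp Require Import all_classical all_reals all_analysis.

Set Implicit Arguments.
Unset Strict Implicit.
Unset Printing Implicit Defensive.

Import Order.TTheory GRing.Theory Num.Theory.
Import numFieldNormedType.Exports.

Local Open Scope classical_set_scope.
Local Open Scope ring_scope.

(* Points of R^3 are column vectors; the library's norm on them is the sup
   norm, used here only for its topology. *)
Definition dot (R : realType) (u v : 'cV[R]_3) : R :=
  \sum_(i < 3) u i 0 * v i 0.

Definition gradient (R : realType) (h : 'cV[R]_3 -> R) (x : 'cV[R]_3) :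
    'cV[R]_3 :=
  \col_i 'D_(delta_mx i 0) h x.

Definition lie_derivative (R : realType) (W : 'cV[R]_3 -> 'cV[R]_3)
    (h : 'cV[R]_3 -> R) (x : 'cV[R]_3) : R :=
  dot (W x) (gradient h x).

Definition sigma1 (R : realType) (x : 'cV[R]_3) : R :=
  \sum_(i < 3) x i 0 ^+ 2 - 1.

Definition Sigma1 (R : realType) : set 'cV[R]_3 := @sigma1 R @^-1` [set 0].

Definition linear_field (R : realType) (A : 'M[R]_3) (x : 'cV[R]_3) :
    'cV[R]_3 := A *m x.

Definition inelastic (R : realType) (X Y : 'cV[R]_3 -> 'cV[R]_3) : Prop :=
  forall x, Sigma1 x ->
    lie_derivative X (@sigma1 R) x = - lie_derivative Y (@sigma1 R) x.

Definition Sigma1star (R : realType) (X Y : 'cV[R]_3 -> 'cV[R]_3) :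
    set 'cV[R]_3 :=
  [set x | Sigma1 x /\
    lie_derivative X (@sigma1 R) x * lie_derivative Y (@sigma1 R) x != 0].

(* Meaningful on Sigma1star only. *)
Definition sliding_formula (R : realType) (X Y : 'cV[R]_3 -> 'cV[R]_3)
    (x : 'cV[R]_3) : 'cV[R]_3 :=
  let Xs := lie_derivative X (@sigma1 R) x in
  let Ys := lie_derivative Y (@sigma1 R) x in
  (Ys - Xs)^-1 *: (Ys *: X x - Xs *: Y x).

(* The extension by continuity from Sigma1star to Sigma1: the value at x is the
   limit of the sliding formula along Sigma1star at x.  Only its values on
   Sigma1 are ever used; sliding_fieldE below checks that it agrees with any
   continuous extension at every point of the closure of Sigma1star. *)
Definition sliding_field (R : realType) (X Y : 'cV[R]_3 -> 'cV[R]_3)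
    (x : 'cV[R]_3) : 'cV[R]_3 :=
  lim (sliding_formula X Y y @[y --> within (Sigma1star X Y) (nbhs x)]).

Lemma sliding_fieldE (R : realType) (X Y S : 'cV[R]_3 -> 'cV[R]_3) :
  {within @Sigma1 R, continuous S} ->
  (forall y, Sigma1star X Y y -> S y = sliding_formula X Y y) ->
  forall x, Sigma1 x -> closure (Sigma1star X Y) x ->
  sliding_field X Y x = S x.
Proof.
move=> cS SE x Sx clx.
have PF : ProperFilter (within (Sigma1star X Y) (nbhs x)).
  exact: within_nbhs_proper.
apply: cvg_lim; first exact: norm_hausdorff.
have /subspace_continuousP/(_ x Sx) cSx := cS.
move=> U /cSx; rewrite /= /nbhs /= /within /= => SU.
near=> y => yS; rewrite -SE//.
by apply: (near SU y) => //; case: yS.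
Unshelve. all: by end_near.
Qed.

(* A solution defined on an open interval J of times; the values of gamma
   outside J are irrelevant. *)
Definition integral_curve (R : realType) (S : 'cV[R]_3 -> 'cV[R]_3)
    (J : set R) (gamma : R -> 'cV[R]_3) : Prop :=
  [/\ J !=set0, open J, is_interval J &
    forall t, J t -> Sigma1 (gamma t) /\ is_derive t 1 gamma (S (gamma t))].

Definition maximal_integral_curve (R : realType) (S : 'cV[R]_3 -> 'cV[R]_3)
    (J : set R) (gamma : R -> 'cV[R]_3) : Prop :=
  integral_curve S J gamma /\
  forall (J' : set R) (gamma' : R -> 'cV[R]_3),
    integral_curve S J' gamma' -> J `<=` J' ->
    (forall t, J t -> gamma' t = gamma t) -> J' = J.

Definition closed_curve (R : realType) (J : set R) (gamma : R -> 'cV[R]_3) :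
    Prop :=
  [/\ J = setT,
    (exists2 T : R, 0 < T & forall t, gamma (t + T) = gamma t) &
    exists t, gamma t <> gamma 0].

Definition equilibrium (R : realType) (S : 'cV[R]_3 -> 'cV[R]_3)
    (p : 'cV[R]_3) : Prop :=
  Sigma1 p /\ S p = 0.

Definition plane (R : realType) (n : 'cV[R]_3) (c : R) : set 'cV[R]_3 :=
  [set x | dot n x = c].

(* Main.v *)
(* Inelasticity gives (x, (A + B) x) = 0 on the sphere, so M = (A + B) / 2 is
   skew-symmetric, and the sliding formula reduces to x |-> M x at the points
   where it is defined.  These are dense in the sphere, hence S1 x = M x
   everywhere, i.e. S1 x = w (u x x) for a unit vector u and w >= 0, with w > 0
   when S1 is non-trivial.  The equilibria are u and -u.  Rotations about u
   solve the equation; the difference of two solutions is a solution and has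
   constant norm, so there are no others, and a maximal solution is a full
   rotation of period 2 pi / w. *)

Require Import Defs.
From mathcomp Require Import all_boot all_order all_algebra.
From mathcomp Require Import all_classical all_reals all_analysis.
From mathcomp Require Import ring lra.
Set Implicit Arguments.
Unset Strict Implicit.

Import Order.TTheory GRing.Theory Num.Theory.
Import numFieldNormedType.Exports.
Local Open Scope classical_set_scope.
Local Open Scope ring_scope.

(** * Coordinates, the dot product and the function [sigma1] *)

Lemma ord3_ind (P : 'I_3 -> Prop) : P 0 -> P 1 -> P 2 -> forall i, P i.
Proof.
move=> P0 P1 P2 [[|[|[|//]]] lti].
- by rewrite (_ : Ordinal lti = 0) //; apply: val_inj.
- by rewrite (_ : Ordinal lti = 1) //; apply: val_inj.
- by rewrite (_ : Ordinal lti = 2) //; apply: val_inj.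
Qed.

Lemma sum_ord3 (V : nmodType) (F : 'I_3 -> V) :
  \sum_(i < 3) F i = F 0 + F 1 + F 2.
Proof.
rewrite !big_ord_recl big_ord0 addr0 addrA.
by congr (F _ + F _ + F _); apply: val_inj.
Qed.

Section Dot.
Variable R : realType.
Implicit Types (u v x y : 'cV[R]_3) (a : R).

Lemma dotE u v : dot u v = u 0 0 * v 0 0 + u 1 0 * v 1 0 + u 2 0 * v 2 0.
Proof. exact: sum_ord3. Qed.

Lemma dotC u v : dot u v = dot v u.
Proof. by rewrite !dotE; ring. Qed.

Lemma dotDl u v x : dot (u + v) x = dot u x + dot v x.
Proof. by rewrite !dotE !mxE; ring. Qed.

Lemma dotZl a u v : dot (a *: u) v = a * dot u v.
Proof. by rewrite !dotE !mxE; ring. Qed.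

Lemma dotDr u v x : dot x (u + v) = dot x u + dot x v.
Proof. by rewrite dotC dotDl !(dotC x). Qed.

Lemma dotZr a u v : dot u (a *: v) = a * dot u v.
Proof. by rewrite dotC dotZl dotC. Qed.

Lemma dot0r u : dot u 0 = 0.
Proof. by rewrite dotE !mxE !mulr0 !addr0. Qed.

Lemma dot_ge0 u : 0 <= dot u u.
Proof. by rewrite dotE -!expr2 !addr_ge0 ?sqr_ge0. Qed.

Lemma dot_eq0 u : (dot u u == 0) = (u == 0).
Proof.
apply/idP/eqP => [|->]; last by rewrite dot0r.
rewrite dotE -!expr2 !paddr_eq0 ?addr_ge0 ?sqr_ge0// !sqrf_eq0.
move=> /andP[/andP[/eqP u0 /eqP u1] /eqP u2].
by apply/colP; apply: ord3_ind; rewrite mxE.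
Qed.

Lemma dot_gt0 u : (0 < dot u u) = (u != 0).
Proof. by rewrite lt_def dot_eq0 dot_ge0 andbT. Qed.

Lemma Sigma1E x : Sigma1 x <-> dot x x = 1.
Proof.
rewrite /Sigma1 /preimage /= /sigma1 sum_ord3 dotE -!expr2.
by split=> [/eqP|->]; rewrite ?subrr// subr_eq0 => /eqP.
Qed.

Lemma gradient_sigma1 x : gradient (@sigma1 R) x = 2 *: x.
Proof.
apply/colP => i; rewrite !mxE /derive.
apply: cvg_lim; first exact: Rhausdorff.
(* For [h != 0] the difference quotient along the [i]-th axis is exactly [h + 2 * x i 0], which
   tends to [0 + 2 * x i 0]. *)
have -> : 2 * x i 0 = 0 + 2 * x i 0 by rewrite add0r.
apply: (@cvg_trans _ ((h + 2 * x i 0) @[h --> (0:R)^'])); last first.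
  by apply: cvgD; [exact: nbhs_dnbhs|exact: cvg_cst].
apply: near_eq_cvg; near=> h.
have h0 : h != 0 by near: h; exact: nbhs_dnbhs_neq.
rewrite /sigma1 /GRing.scale /= !sum_ord3 !mxE.
by move: i; apply: ord3_ind; rewrite /=; field.
Unshelve. all: by end_near.
Qed.

Lemma lie_sigma1 (W : 'cV[R]_3 -> 'cV[R]_3) x :
  lie_derivative W (@sigma1 R) x = 2 * dot (W x) x.
Proof. by rewrite /lie_derivative gradient_sigma1 dotZr. Qed.

Lemma unit_scale x : x != 0 ->
  dot ((Num.sqrt (dot x x))^-1 *: x) ((Num.sqrt (dot x x))^-1 *: x) = 1.
Proof.
rewrite -dot_gt0 => x0; rewrite dotZl dotZr mulrA.
rewrite -invfM -expr2 sqr_sqrtr ?ltW//.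
by rewrite mulVf// gt_eqF.
Qed.

End Dot.

(** * The cross product and skew-symmetric matrices *)

Section Cross.
Variable R : realType.
Implicit Types (u v x y g : 'cV[R]_3) (a w : R).

(* The indices are in Z/3. *)
Definition cross u v : 'cV[R]_3 :=
  \col_i (u (i + 1) 0 * v (i + 2) 0 - u (i + 2) 0 * v (i + 1) 0).

Lemma cross0E u v : cross u v 0 0 = u 1 0 * v 2 0 - u 2 0 * v 1 0.
Proof. by rewrite mxE !add0r. Qed.

Lemma cross1E u v : cross u v 1 0 = u 2 0 * v 0 0 - u 0 0 * v 2 0.
Proof.
rewrite mxE (_ : (1 + 1 : 'I_3) = 2); last exact: val_inj.
by rewrite (_ : (1 + 2 : 'I_3) = 0) //; exact: val_inj.
Qed.

Lemma cross2E u v : cross u v 2 0 = u 0 0 * v 1 0 - u 1 0 * v 0 0.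
Proof.
rewrite mxE (_ : (2 + 1 : 'I_3) = 0); last exact: val_inj.
by rewrite (_ : (2 + 2 : 'I_3) = 1) //; exact: val_inj.
Qed.

Definition crossE := (cross0E, cross1E, cross2E).

Lemma crossDr u v x : cross x (u + v) = cross x u + cross x v.
Proof. by apply/colP => i; rewrite !mxE; ring. Qed.

Lemma crossZr a u v : cross u (a *: v) = a *: cross u v.
Proof. by apply/colP => i; rewrite !mxE; ring. Qed.

Lemma crossZl a u v : cross (a *: u) v = a *: cross u v.
Proof. by apply/colP => i; rewrite !mxE; ring. Qed.

Lemma crossvv u : cross u u = 0.
Proof. by apply/colP => i; rewrite !mxE; ring. Qed.

Lemma dot_cross u v : dot (cross u v) v = 0.
Proof. by rewrite dotE !crossE; ring. Qed.

Lemma dot_crossl u v : dot u (cross u v) = 0.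
Proof. by rewrite dotE !crossE; ring. Qed.

Lemma double_cross u v : cross u (cross u v) = dot u v *: u - dot u u *: v.
Proof.
by apply/colP; apply: ord3_ind; rewrite !crossE !mxE !dotE; ring.
Qed.

Lemma lagrange_identity u v :
  dot (cross u v) (cross u v) = dot u u * dot v v - dot u v ^+ 2.
Proof. by rewrite !dotE !crossE; ring. Qed.

(* The expansion of [x] on [u], [v], [u x v], cleared of denominators. *)
Lemma cross_basis u v x :
  (dot u u * dot v v - dot u v ^+ 2) *: x =
  (dot v x * dot u u - dot u v * dot u x) *: v
  + dot (cross u v) x *: cross u v
  + (dot u x * dot v v - dot u v * dot v x) *: u.
Proof.
move: (cross u v) (cross0E u v) (cross1E u v) (cross2E u v) => c c0 c1 c2.
by apply/colP; apply: ord3_ind; rewrite !mxE !dotE c0 c1 c2; ring.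
Qed.

(** For a unit [u], [double_cross] turns [cross u x = 0] into [x = dot u x *: u], and the norm of
    [x] forces the coefficient to be 1 or -1. *)
Lemma cross_eq0 u x : dot u u = 1 -> dot x x = 1 ->
  cross u x = 0 <-> x = u \/ x = - u.
Proof.
move=> u1 x1; split=> [ux0|[->|->]]; last 2 first.
- exact: crossvv.
- by rewrite -scaleN1r crossZr crossvv scaler0.
have := double_cross u x; rewrite ux0 u1 scale1r => /esym/eqP.
rewrite (_ : cross u 0 = 0); last by rewrite -(scale0r u) crossZr !scale0r.
rewrite subr_eq0 => /eqP xE.
move: x1; rewrite -xE dotZl dotZr u1 mulr1 -expr2 => /eqP.
rewrite sqrf_eq1 => /orP[] /eqP ->; rewrite ?scale1r ?scaleN1r; by [left|right].
Qed.

(** The axial vector of a skew-symmetric matrix, with indices in Z/3: its entries are [M 2 1],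
    [M 0 2], [M 1 0]. *)
Definition axial (M : 'M[R]_3) : 'cV[R]_3 := \col_i M (i + 2) (i + 1).

(** Polarisation: the quadratic form at the basis vectors gives [M i i = 0], and at their pairwise
    sums [M i j = - M j i]. *)
Lemma skew_cross (M : 'M[R]_3) x : (forall y, dot (M *m y) y = 0) ->
  M *m x = cross (axial M) x.
Proof.
move=> M0.
have ME y : dot (M *m y) y =
    (M 0 0 * y 0 0 + M 0 1 * y 1 0 + M 0 2 * y 2 0) * y 0 0
  + (M 1 0 * y 0 0 + M 1 1 * y 1 0 + M 1 2 * y 2 0) * y 1 0
  + (M 2 0 * y 0 0 + M 2 1 * y 1 0 + M 2 2 * y 2 0) * y 2 0.
  by rewrite dotE !mxE !sum_ord3.
pose e i : 'cV[R]_3 := delta_mx i 0.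
have := M0 (e 0); have := M0 (e 1); have := M0 (e 2).
have := M0 (e 0 + e 1); have := M0 (e 1 + e 2); have := M0 (e 0 + e 2).
rewrite !ME !mxE /= !(mulr1, mulr0, addr0, add0r, mulr1n) => *.
have a0 : axial M 0 0 = M 2 1 by rewrite mxE !add0r.
have a1 : axial M 1 0 = M 0 2.
  by rewrite mxE; congr (M _ _); apply: val_inj.
have a2 : axial M 2 0 = M 1 0.
  by rewrite mxE; congr (M _ _); apply: val_inj.
move: (axial M) a0 a1 a2 => v a0 a1 a2.
apply/colP; apply: ord3_ind; rewrite crossE !mxE sum_ord3 ?a0 ?a1 ?a2.
- have -> : M 0 0 = 0 by lra.
  have -> : M 0 1 = - M 1 0 by lra.
  by ring.
- have -> : M 1 1 = 0 by lra.
  have -> : M 1 2 = - M 2 1 by lra.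
  by ring.
- have -> : M 2 2 = 0 by lra.
  have -> : M 2 0 = - M 0 2 by lra.
  by ring.
Qed.

End Cross.

(** * The sliding field of an inelastic linear pair *)

Section SlidingField.
Variables (R : realType) (A B : 'M[R]_3).
Let X := linear_field A.
Let Y := linear_field B.

Lemma mulmx_continuous (M : 'M[R]_3) :
  continuous (fun x : 'cV[R]_3 => M *m x : 'cV[R]_3).
Proof.
move=> x.
have ME y : M *m y = y 0 0 *: col 0 M + y 1 0 *: col 1 M + y 2 0 *: col 2 M.
  by apply/colP => i; rewrite !mxE sum_ord3; ring.
rewrite (funext ME).
apply: (@cvgD _ _ _ (nbhs x)); first apply: (@cvgD _ _ _ (nbhs x)).
all: by apply: cvgZ; [exact: coord_continuous|exact: cvg_cst].
Qed.

Lemma dot_continuous : continuous (fun x : 'cV[R]_3 => dot x x).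
Proof.
move=> x; rewrite (funext (fun y => dotE y y)).
apply: (@cvgD _ _ _ (nbhs x)); first apply: (@cvgD _ _ _ (nbhs x)).
all: by apply: cvgM; exact: coord_continuous.
Qed.

(** Inelasticity speaks of unit vectors only; the form is homogeneous of degree 2, so a nonzero [x]
    may be normalised. *)
Lemma inelastic_skew : inelastic X Y ->
  forall x, dot ((2^-1 *: (A + B)) *m x) x = 0.
Proof.
move=> XY x; rewrite -scalemxAl dotZl mulmxDl dotDl.
have [->|x0] := eqVneq x 0; first by rewrite !dot0r addr0 mulr0.
have /Sigma1E := unit_scale x0; set k := (Num.sqrt _)^-1 => /XY.
have k0 : k != 0 by rewrite invr_eq0 sqrtr_eq0 -ltNge dot_gt0.
rewrite !lie_sigma1 /X /Y /linear_field -!scalemxAr !dotZl !dotZr.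
move=> /eqP; rewrite -addr_eq0 -!mulrDr !mulf_eq0 (negbTE k0) pnatr_eq0 /=.
by move=> /eqP ->; rewrite mulr0.
Qed.

(** Once the derivative along [X] is replaced by [- q], with [q] the one along [Y], the formula
    reads [(q + q)^-1 *: (q *: X x + q *: Y x)] and the nonzero [q] cancels. *)
Lemma sliding_formulaE x : inelastic X Y -> Sigma1star X Y x ->
  sliding_formula X Y x = (2^-1 *: (A + B)) *m x.
Proof.
move=> XY [/XY]; rewrite /sliding_formula => ->.
rewrite mulNr oppr_eq0 mulf_eq0 orbb.
set q := lie_derivative _ _ _ => q0.
rewrite opprK scaleNr opprK -scalerDr scalerA -scalemxAl mulmxDl.
by rewrite -mulr2n -[q *+ 2]mulr_natl invfM mulfVK.
Qed.

(* If the quadratic form [q x = (Ax, x)] vanished on the sphere near [x], then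
   [q (x + t z) + q (x - t z) = 2 q x + 2 t^2 q z] would force [q z = 0]. *)
Lemma Sigma1star_dense x : inelastic X Y -> Sigma1star X Y !=set0 ->
  Sigma1 x -> closure (Sigma1star X Y) x.
Proof.
move=> XY [z [z1 qz]] x1 U Ux; apply: contrapT => noU.
pose q (y : 'cV[R]_3) := dot (A *m y) y.
(* By inelasticity the product defining [Sigma1star] is minus a square, that of [2 * q y]. *)
have starE y : Sigma1 y -> Sigma1star X Y y <-> q y != 0.
  move=> y1; rewrite /Sigma1star /= -[_ * _ in X in X <-> _]opprK -mulrN.
  rewrite -(XY _ y1) lie_sigma1 oppr_eq0 !mulf_eq0 orbb pnatr_eq0 /=.
  by split=> [[]|].
have {qz}qz : q z != 0 by apply/starE.
pose n (y : 'cV[R]_3) := (Num.sqrt (dot y y))^-1 *: y.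
have xx1 : dot x x = 1 by apply/Sigma1E.
have nx : n x = x by rewrite /n xx1 sqrtr1 invr1 scale1r.
have cn : n y @[y --> x] --> n x.
  apply: (@cvgZ _ _ _ (nbhs x)) => //; apply: cvgV.
    by rewrite xx1 sqrtr1 oner_neq0.
  by apply: continuous_comp; [exact: dot_continuous|exact: sqrt_continuous].
(* The vanishing of [q] spreads from the sphere to a full neighbourhood of [x]: [n] is continuous at
   [x], and [q (n y)] is a nonzero multiple of [q y]. *)
have q0 : \forall y \near x, q y = 0.
  have : \forall y \near x, U (n y) by apply: cn; rewrite nx.
  have : \forall y \near x, 0 < dot y y.
    apply: (@dot_continuous x [set r | 0 < r]); rewrite xx1; exact: lt_nbhsr.
  apply: filterS2 => y y0 Uny; apply: contrapT => /eqP qy.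
  apply: noU; exists (n y); split=> //; apply/starE.
    by apply/Sigma1E/unit_scale; rewrite -dot_gt0.
  rewrite /q -scalemxAr dotZl dotZr.
  by rewrite !mulf_neq0// invr_eq0 sqrtr_eq0 -ltNge.
(* The sign [s] will be 1 and -1, for the two displacements from [x] along [z]. *)
have cl (s : R) : (x + (s * t) *: z) @[t --> (0 : R)] --> x.
  rewrite -[X in _ --> X]addr0; apply: cvgD; first exact: cvg_cst.
  rewrite -(scale0r z); apply: cvgZ; last exact: cvg_cst.
  rewrite -[X in _ --> X](mulr0 s).
  by apply: cvgM; [exact: cvg_cst|exact: cvg_id].
have : \forall t \near (0 : R)^', False.
  near=> t.
  have t0 : t != 0 by near: t; exact: nbhs_dnbhs_neq.
  have : q (x + (1 * t) *: z) = 0.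
    by near: t; apply: nbhs_dnbhs; exact: (cl 1 _ q0).
  have : q (x + (- 1 * t) *: z) = 0.
    by near: t; apply: nbhs_dnbhs; exact: (cl (- 1) _ q0).
  have : q x = 0 by exact: nbhs_singleton q0.
  rewrite /q !mulmxDr -!scalemxAr !(dotDl, dotDr) !(dotZl, dotZr) => -> e1 e2.
  have : t ^+ 2 * q z = 0 by rewrite /q; lra.
  by move/eqP; rewrite mulf_eq0 sqrf_eq0 (negbTE t0) (negbTE qz).
by move/filter_not_empty.
Unshelve. all: by end_near.
Qed.

(** The linear map is continuous and agrees with the sliding formula on [Sigma1star], which is dense
    in the sphere, so [sliding_fieldE] identifies the extension. *)
Lemma sliding_field_linear x : inelastic X Y -> Sigma1star X Y !=set0 ->
  Sigma1 x -> sliding_field X Y x = (2^-1 *: (A + B)) *m x.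
Proof.
move=> XY star0 x1.
apply: (sliding_fieldE (S := fun y => (2^-1 *: (A + B)) *m y)) => //.
- exact/continuous_subspaceT/mulmx_continuous.
- by move=> y /(sliding_formulaE XY).
- exact: Sigma1star_dense.
Qed.

End SlidingField.

(** * Tools from calculus: derivatives by entries, constancy, angles *)

Lemma is_derive_mxP (R : realType) m n (V : normedModType R)
    (M : V -> 'M[R]_(m, n)) (x v : V) (dM : 'M[R]_(m, n)) :
  is_derive x v M dM <->
  forall i j, is_derive x v (fun y => M y i j) (dM i j).
Proof.
split=> [Md i j|Md].
  have Md' : derivable M x v by exact: ex_derive.
  apply: DeriveDef; first by move/derivable_mxP : Md'.
  by rewrite -(derive_val (is_derive := Md)) derive_mx// mxE.
have Md' : derivable M x v by apply/derivable_mxP => i j; exact: ex_derive.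
apply: DeriveDef => //; rewrite derive_mx//; apply/matrixP => i j.
by rewrite mxE; exact: derive_val.
Qed.

Lemma is_derive_0_cst_on (R : realType) (J : set R) (f : R -> R) :
  is_interval J -> (forall t, J t -> is_derive t 1 f 0) ->
  forall s t, J s -> J t -> f s = f t.
Proof.
move=> itvJ f0 s t; wlog st : s t / s <= t => [wh Js Jt|Js Jt].
  by case/orP: (le_total s t) => ?; [|symmetry]; exact: wh.
have fJ y : y \in `[s, t] -> is_derive y 1 f 0.
  by rewrite in_itv/= => /(itvJ _ _ Js Jt) /f0.
have fd y : y \in `]s, t[ -> is_derive y 1 f ((fun=> 0) y).
  by move=> /subset_itv_oo_cc /fJ.
have fc : {within `[s, t], continuous f}.
  by apply: derivable_within_continuous => y /fJ ?; exact: ex_derive.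
have [c _] := MVT_segment st fd fc.
by rewrite mul0r => /eqP; rewrite subr_eq0 => /eqP.
Qed.

(** The angle [acos a] has sine [|b|]; the sign of [b] decides between it and its opposite. *)
Lemma cos_sin_exists (R : realType) (a b : R) : a ^+ 2 + b ^+ 2 = 1 ->
  exists t, cos t = a /\ sin t = b.
Proof.
move=> ab1.
have a1 : -1 <= a <= 1 by apply/andP; split; nra.
have ca : cos (acos a) = a by apply: acosK; rewrite in_itv.
have sa : sin (acos a) = `|b|.
  by rewrite sin_acos// -sqrtr_sqr; congr Num.sqrt; lra.
have [b0|b0] := leP 0 b.
  by exists (acos a); rewrite ca sa ger0_norm.
by exists (- acos a); rewrite cosN sinN ca sa ltr0_norm// opprK.
Qed.

(** * Rotations about a unit axis as solutions of the linear equation *)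

Section Rotation.
Variables (R : realType) (u : 'cV[R]_3) (w : R).
Implicit Types (x g : 'cV[R]_3) (s t a : R).
Implicit Types (J : set R) (gamma : R -> 'cV[R]_3).

(** The equation is posed in the whole space, without the sphere constraint of [integral_curve], so
    that differences of solutions are solutions. *)
Definition rotation_flow J gamma :=
  forall t, J t -> is_derive t 1 gamma (w *: cross u (gamma t)).

(** The derivative of the squared norm is [2 * w * dot (cross u (gamma r)) (gamma r)], which is 0 by
    orthogonality. *)
Lemma rotation_flow_dot J gamma s t : is_interval J -> rotation_flow J gamma ->
  J s -> J t -> dot (gamma s) (gamma s) = dot (gamma t) (gamma t).
Proof.
move=> itvJ gammaJ.
pose f r := dot (gamma r) (gamma r).
apply: (is_derive_0_cst_on (f := f) itvJ) => r Jr.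
have /is_derive_mxP gd := gammaJ r Jr.
rewrite (_ : f = (fun r => gamma r 0 0) ^+ 2
    + (fun r => gamma r 1 0) ^+ 2 + (fun r => gamma r 2 0) ^+ 2); last first.
  by apply/funext => y; rewrite /f dotE -!expr2 !fctE.
apply: (is_derive_eq (is_deriveD (is_deriveD
  (is_deriveX 2 (gd 0 0)) (is_deriveX 2 (gd 1 0))) (is_deriveX 2 (gd 2 0)))).
move: (cross u (gamma r)) (dot_cross u (gamma r)) => v v0.
rewrite -[RHS](mulr0 (2 * w)) -v0 dotE !mxE /GRing.scale /=.
by ring.
Qed.

Lemma rotation_flow_unique J gamma gamma' s : is_interval J ->
  rotation_flow J gamma -> rotation_flow J gamma' -> J s ->
  gamma s = gamma' s -> forall t, J t -> gamma t = gamma' t.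
Proof.
move=> itvJ gJ g'J Js gs t Jt; apply/eqP; rewrite -subr_eq0 -dot_eq0.
have dJ : rotation_flow J (gamma - gamma').
  move=> r Jr; have gd := gJ r Jr; have g'd := g'J r Jr.
  apply: is_derive_eq; rewrite -scalerBr; congr (_ *: _).
  by rewrite -[- cross _ _]scaleN1r -crossZr -crossDr scaleN1r.
have := rotation_flow_dot itvJ dJ Js Jt.
by rewrite !fctE gs subrr dot0r => <-.
Qed.

Hypothesis u1 : dot u u = 1.

(* Rodrigues' formula. *)
Definition rotation a x :=
  cos a *: x + sin a *: cross u x + ((1 - cos a) * dot u x) *: u.

Lemma rotation0 x : rotation 0 x = x.
Proof. by rewrite /rotation cos0 sin0 subrr mul0r !scale0r !addr0 scale1r. Qed.

Lemma rotationE a x i :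
  rotation a x i 0 =
  x i 0 * cos a + cross u x i 0 * sin a + dot u x * u i 0 * (1 - cos a).
Proof. by rewrite /rotation; move: (cross u x) => v; rewrite !mxE; ring. Qed.

Lemma dot_rotation a x : dot u (rotation a x) = dot u x.
Proof. by rewrite /rotation !dotDr !dotZr u1 dot_crossl; ring. Qed.

(** The right-hand side is also the derivative of [rotation a x] in [a]; this is why rotations solve
    the equation. *)
Lemma cross_rotation a x :
  cross u (rotation a x) = cos a *: cross u x + sin a *: (dot u x *: u - x).
Proof.
rewrite /rotation !crossDr !crossZr crossvv scaler0 addr0.
by rewrite double_cross u1 scale1r.
Qed.

Lemma rotation_flowP x s J :
  rotation_flow J (fun t => rotation (w * (t - s)) x).
Proof.
move=> t _; apply/is_derive_mxP => i j; rewrite cross_rotation ord1 {j}.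
under eq_fun do rewrite rotationE.
have hd : is_derive t 1 (fun r : R => w * (r - s)) w.
  have := is_deriveZ w
    (is_deriveB (is_derive_id t 1) (is_derive_cst s t (1 : R))).
  by rewrite subr0 /GRing.scale /= mulr1.
have cd := is_derive1_comp (g := fun r => w * (r - s)) (is_derive_cos _) hd.
have sd := is_derive1_comp (g := fun r => w * (r - s)) (is_derive_sin _) hd.
have bd := is_deriveB (is_derive_cst (1 : R) t (1 : R)) cd.
apply: (is_derive_eq (is_deriveD
  (is_deriveD (is_deriveZ (x i 0) cd) (is_deriveZ (cross u x i 0) sd))
  (is_deriveZ (dot u x * u i 0) bd))).
move: (cross u x) => v; rewrite !mxE /GRing.scale /=.
by ring.
Qed.

Lemma rotation_periodic a x : rotation (a + pi *+ 2) x = rotation a x.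
Proof. by rewrite /rotation cosD2pi sinD2pi. Qed.

Lemma rotation_fixed a x : cross u x = 0 -> rotation a x = x.
Proof.
move=> ux0; rewrite /rotation ux0 scaler0 addr0 -scalerA.
have := double_cross u x; rewrite ux0 u1 scale1r => /esym/eqP.
rewrite -(scale0r u) crossZr !scale0r subr_eq0 => /eqP ->.
by rewrite -scalerDl addrC subrK scale1r.
Qed.

(** By [cross_basis], [x] expands on [g], [cross u g] and [u]; comparison with Rodrigues' formula
    for [g] reads off the cosine and sine of the angle. Here [k] is the squared norm of
    [cross u g]. *)
Lemma rotation_transitive g x : dot g g = dot x x ->
  dot u g = dot u x -> cross u g != 0 -> exists a, rotation a g = x.
Proof.
move=> gx ugx; rewrite -dot_eq0 lagrange_identity u1 mul1r.
have := cross_basis u g x; rewrite u1 mul1r ugx mulr1.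
set c := dot u x; set d := dot (cross u g) x; set e := dot g x => xE.
set k := (X in X != 0) => k0.
have xE' : dot (k *: x) x = k * dot x x by rewrite dotZl.
move: xE'; rewrite xE -gx !dotDl !dotZl -/d -/e -/c => E.
(* [E], the product of the expansion with [x], says that the squares of these two numbers sum to
   1. *)
have [|a [ca sa]] := @cos_sin_exists R ((e - c * c) / k) (d / k).
  rewrite !expr_div_n -mulrDl; apply: (canLR (mulfK _)); rewrite ?expf_neq0//.
  by rewrite /k in E *; lra.
exists a; rewrite /rotation ca sa ugx -/c.
apply: (scalerI k0); rewrite xE !scalerDr !scalerA.
congr (_ *: _ + _ *: _ + _ *: _).
- by field.
- by field.
by rewrite /k; field.
Qed.

End Rotation.

(** * Equilibria and trajectories of the sliding field *)

Unset Implicit Arguments.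

Theorem theoremA (R : realType) (A B : 'M[R]_3) :
  let X := linear_field A in
  let Y := linear_field B in
  let S1 := sliding_field X Y in
  inelastic X Y ->
  Sigma1star X Y !=set0 ->
  (exists2 x, Sigma1 x & S1 x <> 0) ->
  exists pp pm : 'cV[R]_3,
    [/\ pp <> pm,
        (forall x, equilibrium S1 x <-> x = pp \/ x = pm) &
        forall (J : set R) (gamma : R -> 'cV[R]_3),
          maximal_integral_curve S1 J gamma ->
          gamma @` J <> [set pp] -> gamma @` J <> [set pm] ->
          closed_curve J gamma /\
          exists c : R, gamma @` J = @Sigma1 R `&` plane (pp - pm) c].
Proof.
move=> X Y S1 XY star0 [z z1 Sz].
(* [om] is the angular velocity, [w] the angular speed and [u] the unit axis. *)
set om := axial (2^-1 *: (A + B)); set w := Num.sqrt (dot om om).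
pose u := w^-1 *: om.
have S1om x : Sigma1 x -> S1 x = cross om x.
  move=> x1; rewrite /S1 sliding_field_linear// skew_cross//.
  exact: inelastic_skew.
have om0 : om != 0.
  apply/eqP => om0; apply: Sz; rewrite S1om// om0.
  by rewrite -(scale0r om) crossZl !scale0r.
have w_gt0 : 0 < w by rewrite sqrtr_gt0 dot_gt0.
have u1 : dot u u = 1 by exact: unit_scale.
have S1E x : Sigma1 x -> S1 x = w *: cross u x.
  by move=> /S1om ->; rewrite -crossZl scalerA mulfV ?gt_eqF// scale1r.
have equil x : equilibrium S1 x <-> x = u \/ x = - u.
  split=> [[x1 /eqP]|xE].
    rewrite S1E// scaler_eq0 gt_eqF//= => /eqP.
    by move/Sigma1E : x1 => x1 /cross_eq0; apply.
  have x1 : dot x x = 1.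
    by case: xE => ->; rewrite // -scaleN1r dotZl dotZr u1; ring.
  split; first exact/Sigma1E.
  by rewrite S1E ?(cross_eq0 u1 x1).2 ?scaler0//; exact/Sigma1E.
exists u, (- u); split=> //.
  move=> uN; have : dot u (- u) = 1 by rewrite -uN.
  by rewrite -scaleN1r dotZr u1; lra.
move=> J gamma [[[s Js] oJ itvJ sol] maxJ] Nu Nnu.
pose g := gamma s; pose flow t := rotation u (w * (t - s)) g.
have g1 : dot g g = 1 by apply/Sigma1E; exact: (sol s Js).1.
have flows : flow s = g by rewrite /flow subrr mulr0 rotation0.
have flowP : rotation_flow u w setT flow by exact: rotation_flowP.
have flow1 t : Sigma1 (flow t).
  apply/Sigma1E; rewrite -g1 -flows.
  by apply: (rotation_flow_dot _ flowP) => // ? ? _ _ ? _.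
have flowJ t : J t -> flow t = gamma t.
  apply: (rotation_flow_unique itvJ (s := s)) => //.
  - by move=> r _; exact: flowP.
  - by move=> r /sol[r1 gd]; rewrite -S1E.
(* The rotation orbit through [g] is a solution for all times that extends [gamma], so maximality
   makes [J] the whole line. *)
have JT : setT = J.
  apply: (maxJ setT flow) => //; split=> //; [by exists s|exact: openT|].
  by move=> t _; split=> //; rewrite S1E//; exact: flowP.
have gammaE t : gamma t = flow t by rewrite flowJ// -JT.
(* Otherwise [g] is [u] or [- u], every rotation fixes it, and the trajectory is one of the two
   excluded equilibria. *)
have ug0 : cross u g != 0.
  apply/eqP => ug0.
  have im : gamma @` J = [set g].
    apply/seteqP; split=> [_ [t _ <-]|_ ->] /=; last by exists s.
    by rewrite gammaE /flow rotation_fixed.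
  by case/(cross_eq0 u1 g1) : ug0 => gE; [apply: Nu|apply: Nnu]; rewrite im gE.
split.
  split=> //.
    exists (pi *+ 2 / w) => [|t].
      by rewrite divr_gt0// pmulrn_rgt0// pi_gt0.
    rewrite !gammaE /flow -(rotation_periodic u (w * (t - s))).
    congr (rotation _ _ _).
    by field; rewrite gt_eqF.
  (* A constant [gamma] would have zero velocity at [s], where the velocity is [w *: cross u g]. *)
  apply: contrapT => ct.
  have cst_gamma : gamma = cst (gamma 0).
    by apply/funext => t; apply: contrapT => tE; apply: ct; exists t.
  have [_ gd] := sol s Js.
  have := @derive_val _ _ _ _ _ _ _ gd.
  rewrite cst_gamma derive_cst -cst_gamma S1E; last by apply/Sigma1E.
  by move=> /esym/eqP; rewrite scaler_eq0 gt_eqF//= (negbTE ug0).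
(* The normal [u - - u] is twice [u], whence the factor 2. *)
exists (2 * dot u g).
have planeE y : plane (u - - u) (2 * dot u g) y <-> dot u y = dot u g.
  rewrite /plane /= opprK dotDl -mulr2n -[_ *+ 2]mulr_natl.
  have two_neq0 : 2 != 0 :> R by rewrite pnatr_eq0.
  by split=> [/(mulfI two_neq0)|->].
apply/seteqP; split=> [_ [t _ <-]|y [/Sigma1E y1 /planeE uy]].
  by rewrite gammaE; split=> //; apply/planeE; rewrite dot_rotation.
(* Every point [y] of the circle is a rotation of [g] by some angle [a]; at angular speed [w],
   starting from [g] at time [s], it is reached at time [s + a / w]. *)
have [a aE] : exists a, rotation u a g = y.
  by apply: rotation_transitive => //; rewrite g1.
exists (s + a / w); first by rewrite -JT.
rewrite gammaE /flow -aE; congr (rotation _ _ _).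
by field; rewrite gt_eqF.
Qed.
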